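(* For $\ell=1,2,\dots$, let $\pi_\ell$ be the look-ahead policy produced by value iteration started from $V_0=0$, i.e. a stationary policy with $$\pi_\ell(q)\in\arg\max_{s\in\mathcal P}\left\{ r(q,s)+\beta\,\mathbb{E}\big[V_\ell((q-s)^++A)\big]\right\},\qquad q\in\mathbb{Z}_+^{\mathcal I}.$$ Then $J_\beta(\cdot,\pi_\ell)$ converges to $V^*_\beta(\cdot)$ as $\ell\to\infty$ (in the sense that $\|J_\beta(\cdot,\pi_\ell)-V^*_\beta\|\to 0$). More precisely, if for some $\varepsilon>0$ $$\|V_{\ell+1}-V_\ell\|<\frac{\varepsilon(1-\beta)^2}{2\beta^2},$$ then $\|J_\beta(\cdot,\pi_\ell)-V^*_\beta\|<\varepsilon$.
   Context: Let $\mathcal I=\{(i,j): i,j\in\{1,2\}\}$ index the four queues of a $2\times 2$ input-queued switch (queue $(i,j)$ is for input port $i$ and output port $j$); $\mathbb{Z}_+=\{0,1,2,\dots\}$. A schedule is a vector $s=(s_\rho)_{\rho\in\mathcal I}\in\{0,1\}^{\mathcal I}$ with $\sum_j s_{(i,j)}\le 1$ for each $i$ and $\sum_i s_{(i,j)}\le 1$ for each $j$; $\mathcal P$ is the set of all schedules. In each time slot $t\in\mathbb{Z}_+$ a policy $\pi$ selects a schedule $S^\pi(t)\in\mathcal P$; $A_\rho(t)\in\mathbb{Z}_+$ is the number of arrivals to queue $\rho$ in slot $t$. The variables $A_\rho(t)$, $\rho\in\mathcal I,t\in\mathbb{Z}_+$, are independent and, for fixed $\rho$, identically distributed in $t$ with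 mean $\lambda_\rho$, where $\sum_i\lambda_{(i,j)}<1$ for each $j$ and $\sum_j\lambda_{(i,j)}<1$ for each $i$; $A$ denotes a random vector with the law of $(A_\rho(t))_{\rho\in\mathcal I}$. Queue lengths evolve by $Q^\pi_\rho(t+1)=[Q^\pi_\rho(t)-S^\pi_\rho(t)]^++A_\rho(t)$, $Q^\pi(0)=q$, with $[x]^+=\max\{x,0\}$ (componentwise for vectors, also written $(x)^+$). $\mathcal M$ is the set of stationary Markov policies, i.e. those for which $S^\pi(t)$ depends only on $Q^\pi(t)$ (not on $t$). Fix cost constants $c_\rho\ge 0$ and $\beta\in(0,1)$. Set $J_\beta(q,\pi)=\sum_{t=0}^\infty\mathbb{E}\big[\beta^t\sum_{\rho\in\mathcal I}c_\rho Q^\pi_\rho(t)\big]$ and $V^*_\beta(q)=\min\{J_\beta(q,\pi):\pi\in\mathcal M\}$. The reward is $r(q,s)=\sum_{\rho\in\mathcal I}c_\rho s_\rho\,\mathbb{I}_{\{q_\rho>0\}}$, and the value functions are $V_0\equiv 0$, $V_{n+1}(q)=\max_{s\in\mathcal P}\{r(q,s)+\beta\,\mathbb{E}[V_n((q-s)^++A)]\}$. For a function $V$ on $\mathbb{Z}_+^{\mathcal I}$, $\|V\|=\sup\{|V(q)|: q\in\mathbb{Z}_+^{\mathcal I}\}$. *)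

(* Defs.v *)
From HB Require Import structures.
From mathcomp Require Import all_boot all_order all_algebra.
From mathcomp Require Import all_classical all_reals all_analysis.
Set Implicit Arguments.
Unset Strict Implicit.
Unset Printing Implicit Defensive.
Import Order.TTheory GRing.Theory Num.Theory.
Import numFieldNormedType.Exports.
Local Open Scope classical_set_scope.
Local Open Scope ring_scope.

Definition queue := ('I_2 * 'I_2)%type.
Definition state := {ffun queue -> nat}.
(* Only the vectors satisfying [is_schedule] are schedules. *)
Definition svec := {ffun queue -> bool}.

Definition is_schedule (s : svec) : bool :=
  [forall i : 'I_2, (\sum_(j < 2) s (i, j) <= 1)%N] &&
  [forall j : 'I_2, (\sum_(i < 2) s (i, j) <= 1)%N].

Definition policy := state -> svec.
Definition is_policy (pol : policy) : Prop := forall q, is_schedule (pol q).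

(* [subn] is truncated, so [q rho - s rho] is the positive part. *)
Definition next_state (q : state) (s : svec) (a : queue -> nat) : state :=
  [ffun rho => (q rho - s rho + a rho)%N].

Definition supnorm (R : realType) (f : state -> \bar R) : \bar R :=
  ereal_sup [set `|f q|%E | q in [set: state]].

Definition mutually_independent (R : realType) (d d' : measure_display)
    (T : measurableType d) (T' : measurableType d') (P : probability T R)
    (I : choiceType) (X : I -> {RV P >-> T'}) : Prop :=
  forall (J : seq I) (B : I -> set T'), uniq J ->
    (forall i, i \in J -> measurable (B i)) ->
    P (\bigcap_(i in [set` J]) X i @^-1` B i) =
    (\prod_(i <- J) P (X i @^-1` B i))%E.

Definition identically_distributed (R : realType) (d d' : measure_display)
    (T : measurableType d) (T' : measurableType d') (P : probability T R)
    (X Y : {RV P >-> T'}) : Prop :=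
  forall B : set T', measurable B -> distribution P X B = distribution P Y B.

Section Switch.
Context (R : realType) (d : measure_display) (T : measurableType d).
Context (P : probability T R) (A : queue -> nat -> {RV P >-> nat}).
Context (c : queue -> R) (beta : R).

Fixpoint queue_length (pol : policy) (q : state) (t : nat) (w : T) : state :=
  if t is t'.+1 then
    let q' := queue_length pol q t' w in
    next_state q' (pol q') (fun rho => A rho t' w)
  else q.

Definition discounted_cost (q : state) (pol : policy) : \bar R :=
  (\sum_(0 <= t <oo)
    'E_P[fun w => (beta ^+ t *
      \sum_(rho : queue) c rho * (queue_length pol q t w rho)%:R)%R])%E.

(* The minimum over all policies, written as an infimum so that its
   attainment is not assumed. *)
Definition optimal_cost (q : state) : \bar R :=
  ereal_inf [set discounted_cost q pol | pol in [set pol | is_policy pol]].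

Definition reward (q : state) (s : svec) : R :=
  \sum_(rho : queue) c rho * (s rho)%:R * (0 < q rho)%N%:R.

(* The generic arrival vector is taken to be that of slot 0: the arrival
   vectors of all slots have the same law. Values lie in \bar R so that the
   expectation needs no default value. *)
Definition action_value (V : state -> \bar R) (q : state) (s : svec) : \bar R :=
  ((reward q s)%:E +
   beta%:E * \int[P]_w V (next_state q s (fun rho => A rho 0%N w)))%E.

Fixpoint value (n : nat) (q : state) : \bar R :=
  if n is m.+1 then
    \big[maxe/-oo%E]_(s : svec | is_schedule s) action_value (value m) q s
  else 0%E.

Definition lookahead_policy (l : nat) (pol : policy) : Prop :=
  is_policy pol /\
  forall (q : state) (s : svec), is_schedule s ->
    (action_value (value l) q s <= action_value (value l) q (pol q))%E.

End Switch.

(* Main.v *)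
Require Import Defs.
From HB Require Import structures.
From mathcomp Require Import all_boot all_order all_algebra.
From mathcomp Require Import all_classical all_reals all_analysis.
From mathcomp Require Import measurable_realfun zify ring lra.

(** A stationary policy generates a controlled Markov chain, because the
    arrivals of a slot are independent of everything that determines the queue
    lengths at its beginning; [queue_length_transition] is this fact, and the
    only place where independence and identical distribution are used.

    Serving a nonempty queue [rho] removes exactly [c rho] from the holding
    cost, and the arrivals of one slot add a mean amount [kappa] that does not
    depend on the policy, so the mean holding cost [a t] and the mean reward
    [e t] satisfy [a t.+1 + e t = a t + kappa]. Discounting and summing gives
      [(1 - beta) J = a 0 + beta kappa / (1 - beta) - beta E],
    where [E] is the discounted reward ([discounted_cost_of_reward]): minimising
    the cost is maximising the reward, and differences of [E] become differences
    of [J] multiplied by [beta / (1 - beta)].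

    Write [V_n] for [value n] and [delta] for a bound on [|V_(l+1) - V_l|]. By
    the Bellman recursion every policy satisfies
    [e t + beta E(V_l(Q_(t+1))) <= E(V_(l+1)(Q_t))], with equality for the
    look-ahead policy. The discounted sum of this telescopes, up to one error of
    size at most [delta] in each slot but the first; hence [E] is at most
    [V_(l+1)(q) + beta delta / (1 - beta)] for every policy
    ([discounted_reward_le]) and at least
    [V_(l+1)(q) - beta delta / (1 - beta)] for the look-ahead policy
    ([discounted_reward_ge]). Therefore the cost of the look-ahead policy
    exceeds the optimal cost by at most [2 beta^2 delta / (1 - beta)^2]
    ([lookahead_gap]), uniformly in [q]. This is the quantitative claim, and the
    convergence follows since one may take [delta = beta^l * \sum_rho c rho]
    ([value_gap]). The comparison is made with each policy separately, and
    the infimum over policies is taken afterwards. *)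

Set Implicit Arguments.
Unset Strict Implicit.
Unset Printing Implicit Defensive.
Import Order.TTheory GRing.Theory Num.Theory.
Import numFieldNormedType.Exports.
Local Open Scope classical_set_scope.
Local Open Scope ring_scope.

(** * Integrals of functions of countably-valued variables *)

Section CountableValued.
Context (R : realType) (d : measure_display) (T : measurableType d).
Context (P : probability T R).

Lemma integral_cst_prob (r : \bar R) : (\int[P]_w r = r)%E.
Proof.
rewrite integral_cst// -[RHS]mule1; congr (_ * _)%E.
exact: probability_setT.
Qed.

(** The types of queue lengths and of arrival histories are countable and carry
    no sigma-algebra, so the measurability of a variable with such values is
    that of its fibers. *)
Definition measurable_fibers (S : Type) (X : T -> S) : Prop :=
  forall x, measurable (X @^-1` [set x]).

Lemma measurable_preimage_fibers (S : countType) (X : T -> S) (B : set S) :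
  measurable_fibers X -> measurable (X @^-1` B).
Proof.
move=> mX; rewrite (_ : X @^-1` B = \bigcup_(x in B) X @^-1` [set x]).
  rewrite bigcup_mkcond; apply: countable_bigcupT_measurable => [|x].
    exact: countableP.
  by case: ifP.
apply/seteqP; split => [w Bw|w [x Bx /= ->]] //.
by exists (X w).
Qed.

Lemma measurable_fun_fibers (S : countType) (X : T -> S) (d' : measure_display)
    (T' : measurableType d') (g : S -> T') (D : set T) :
  measurable_fibers X -> measurable_fun D (fun w => g (X w)).
Proof.
move=> mX; apply: (@measurable_funS _ _ _ _ setT) => // _ B _.
by rewrite setTI; exact: (@measurable_preimage_fibers _ X (g @^-1` B)).
Qed.

(** The fibers are indexed by [pickle] because countable additivity of the
    integral is available for sequences of sets; codes that are not attained
    give empty pieces. *)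
Lemma ge0_integral_fibers (S : countType) (X : T -> S) (f : T -> \bar R)
    (D : set T) :
  measurable D -> measurable_fibers X -> measurable_fun D f ->
  (forall w, 0 <= f w)%E ->
  (\int[P]_(w in D) f w =
   \sum_(n <oo) \int[P]_(w in D `&` [set w | pickle (X w) = n]) f w)%E.
Proof.
move=> mD mX mf f0.
have DE : D = \bigcup_n (D `&` [set w | pickle (X w) = n]).
  by rewrite -setI_bigcupr; apply/seteqP; split => [w Dw|w []//]; split => //;
     exists (pickle (X w)).
rewrite [in LHS]DE ge0_integral_bigcup //.
- move=> k; apply: measurableI => //.
  exact: (@measurable_preimage_fibers _ X [set x | pickle x = k]).
- by rewrite -DE.
- apply/trivIsetP => i j _ _ /eqP ij.
  by apply/seteqP; split => // w [[_ /= ->] [_ /= /ij]].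
Qed.

Lemma pickle_fiber (S : countType) (X : T -> S) (x : S) :
  [set w | pickle (X w) = pickle x] = X @^-1` [set x].
Proof.
by apply/seteqP; split => w /= => [/(pcan_inj (@pickleK S))|->].
Qed.

Lemma integral_fiber (S : Type) (X : T -> S) (g : S -> \bar R) (D : set T)
    (x : S) :
  measurable D -> measurable_fibers X ->
  (\int[P]_(w in D `&` X @^-1` [set x]) g (X w) =
   g x * P (D `&` X @^-1` [set x]))%E.
Proof.
move=> mD mX; rewrite -integral_cst; last exact: measurableI.
by apply: eq_integral => w; rewrite inE => -[_ /= ->].
Qed.

(** The event [D] is independent of [Y], has probability [p], and [Y'] has the
    law of [Y]: both integrals are sums over the fibers, equal term by term. *)
Lemma ge0_integral_restrict_indep (S : countType) (Y Y' : T -> S) (D : set T)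
    (p : R) (g : S -> \bar R) :
  measurable D -> measurable_fibers Y -> measurable_fibers Y' ->
  (forall y, P (D `&` Y @^-1` [set y]) = p%:E * P (Y' @^-1` [set y]))%E ->
  (forall y, 0 <= g y)%E ->
  (\int[P]_(w in D) g (Y w) = p%:E * \int[P]_w g (Y' w))%E.
Proof.
move=> mD mY mY' DY g0.
rewrite (@ge0_integral_fibers _ Y) ?(@ge0_integral_fibers _ Y' _ setT) //;
  try exact: measurable_fun_fibers.
rewrite -nneseriesZl; last by move=> n _; exact: integral_ge0.
apply: eq_eseriesr => n _.
have [[y <-]|ny] := pselect (exists y : S, pickle y = n).
  by rewrite !pickle_fiber !integral_fiber// DY setTI muleCA.
have n0 (Z : T -> S) : [set w | pickle (Z w) = n] = set0.
  by apply/seteqP; split => // w wn; apply: ny; exists (Z w).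
by rewrite !n0 !setI0 !integral_set0 mule0.
Qed.

(** Fubini for an independent pair of countably-valued variables, [Y'] being a
    copy of [Y]: on each fiber of [X] the integrand depends on [Y] alone. *)
Lemma ge0_integral_indep (S S' : countType) (X : T -> S) (Y Y' : T -> S')
    (f : S -> S' -> \bar R) :
  measurable_fibers X -> measurable_fibers Y -> measurable_fibers Y' ->
  (forall x y, P (X @^-1` [set x] `&` Y @^-1` [set y]) =
     P (X @^-1` [set x]) * P (Y' @^-1` [set y]))%E ->
  (forall x y, 0 <= f x y)%E ->
  (\int[P]_w f (X w) (Y w) = \int[P]_w (\int[P]_w' f (X w) (Y' w')))%E.
Proof.
move=> mX mY mY' XY f0.
have mXY : measurable_fibers (fun w => (X w, Y w)).
  move=> [x y]; rewrite (_ : _ @^-1` _ = X @^-1` [set x] `&` Y @^-1` [set y]).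
    exact: measurableI.
  by apply/seteqP; split => w /= [-> ->].
rewrite (@ge0_integral_fibers _ X) //; last first.
  have := @measurable_fun_fibers _ _ _ (\bar R)
    (fun xy => f xy.1 xy.2) setT mXY.
  exact.
rewrite [RHS](@ge0_integral_fibers _ X) //; last first.
- by move=> w; exact: integral_ge0.
- exact: (@measurable_fun_fibers _ _ _ (\bar R)
    (fun x => (\int[P]_w' f x (Y' w'))%E) setT mX).
apply: eq_eseriesr => n _.
have [[x <-]|nx] := pselect (exists x : S, pickle x = n); last first.
  rewrite (_ : [set w | _] = set0) ?setI0 ?integral_set0//.
  by apply/seteqP; split => // w wn; apply: nx; exists (X w).
rewrite !pickle_fiber.
rewrite (@integral_fiber _ X (fun x => (\int[P]_w' f x (Y' w'))%E))// setTI.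
rewrite (eq_integral (fun w => f x (Y w))); last first.
  by move=> w; rewrite inE => /= ->.
rewrite (ge0_integral_restrict_indep (p := fine (P (X @^-1` [set x])))
  (Y := Y) (Y' := Y'))//.
  by rewrite fineK ?fin_num_measure// muleC.
by move=> y; rewrite fineK ?fin_num_measure.
Qed.

End CountableValued.

(** * Independence of the arrivals from the past *)

Section Arrivals.
Context (R : realType) (d : measure_display) (T : measurableType d).
Context (P : probability T R) (A : queue -> nat -> {RV P >-> nat}).

Definition arrivals (t : nat) (w : T) : state := [ffun rho => A rho t w].

(** The most recent arrivals come first, so that extending the history by one
    slot is [cons] and the queue lengths are a fold of it (see [run]). *)
Fixpoint arrival_history (t : nat) (w : T) : seq state :=
  if t is t'.+1 then arrivals t' w :: arrival_history t' w else [::].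

Definition cylinder (J : seq (queue * nat)) (k : queue * nat -> nat) : set T :=
  \bigcap_(i in [set` J]) A i.1 i.2 @^-1` [set k i].

(** The variables of one slot, as a list of indices that [mutually_independent]
    accepts. *)
Definition slot (t : nat) : seq (queue * nat) :=
  [seq (rho, t) | rho <- enum {: queue}].

Lemma slot_uniq t : uniq (slot t).
Proof. by rewrite map_inj_uniq; [exact: enum_uniq|move=> rho rho' []]. Qed.

Lemma arrivals_cylinder t y :
  arrivals t @^-1` [set y] = cylinder (slot t) (fun i => y i.1).
Proof.
apply/seteqP; split => [w /= <- i /mapP[rho _ ->] /=|w Jw /=].
  by rewrite ffunE.
apply/ffunP => rho; rewrite ffunE; apply: (Jw (rho, t)) => /=.
by apply/mapP; exists rho => //; rewrite mem_enum.
Qed.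

Lemma cylinder_measurable J k : measurable (cylinder J k).
Proof.
apply: fin_bigcap_measurable => [|i _]; first exact: finite_seq.
by rewrite -[X in measurable X]setTI; exact: measurable_funPT.
Qed.

Lemma arrivals_measurable t : measurable_fibers (arrivals t).
Proof. by move=> y; rewrite arrivals_cylinder; exact: cylinder_measurable. Qed.

Lemma arrival_history_cons t y h :
  arrival_history t.+1 @^-1` [set y :: h] =
  arrival_history t @^-1` [set h] `&` arrivals t @^-1` [set y].
Proof. by apply/seteqP; split => w /= => [[-> ->]|[-> ->]]. Qed.

Lemma arrival_history_nil t : arrival_history t.+1 @^-1` [set [::]] = set0.
Proof. by apply/seteqP; split. Qed.

Lemma arrival_history_measurable t : measurable_fibers (arrival_history t).
Proof.
elim: t => [|t IH] h.
  rewrite (_ : _ @^-1` _ = if h == [::] then setT else set0).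
    by case: ifP.
  by case: h => [|y h]; apply/seteqP; split.
case: h => [|y h]; first by rewrite arrival_history_nil.
by rewrite arrival_history_cons; apply: measurableI; [exact: IH|
   exact: arrivals_measurable].
Qed.

Hypothesis A_indep :
  mutually_independent (fun k : queue * nat => A k.1 k.2).

Lemma cylinder_prob J k : uniq J ->
  (P (cylinder J k) = \prod_(i <- J) P (A i.1 i.2 @^-1` [set k i]))%E.
Proof.
by move=> uJ; rewrite /cylinder (A_indep (B := fun i => [set k i])).
Qed.

(** The prescription of arrivals under which fixing the arrivals of slot [t]
    and a cylinder over later slots becomes a single cylinder. *)
Definition set_slot (t : nat) (y : state) (k : queue * nat -> nat) :
  queue * nat -> nat := fun i => if i.2 == t then y i.1 else k i.

Lemma set_slot_in t y k i : i \in slot t -> set_slot t y k i = y i.1.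
Proof. by case/mapP => rho _ ->; rewrite /set_slot eqxx. Qed.

Lemma set_slot_out t y k i : (t < i.2)%N -> set_slot t y k i = k i.
Proof. by rewrite /set_slot; case: ltngtP. Qed.

Lemma slot_cat_uniq t J : uniq J -> (forall i, i \in J -> (t < i.2)%N) ->
  uniq (slot t ++ J).
Proof.
move=> uJ tJ; rewrite cat_uniq slot_uniq uJ andbT; apply/hasPn => i /tJ ti.
by apply/mapP => -[rho _ ie]; move: ti; rewrite ie ltnn.
Qed.

Lemma arrivals_cylinderI t y J k : (forall i, i \in J -> (t < i.2)%N) ->
  arrivals t @^-1` [set y] `&` cylinder J k =
  cylinder (slot t ++ J) (set_slot t y k).
Proof.
move=> tJ; rewrite arrivals_cylinder; apply/seteqP; split => w.
  move=> [sw Jw] i /=; rewrite mem_cat => /orP[ii|ii].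
    by rewrite set_slot_in//; exact: sw.
  by rewrite set_slot_out ?tJ//; exact: Jw.
move=> sJw; split => i /= ii.
  by have := sJw i; rewrite /= mem_cat ii set_slot_in//; apply.
by have := sJw i; rewrite /= mem_cat ii orbT set_slot_out ?tJ//; apply.
Qed.

Lemma arrivals_cylinder_indep t y J k : uniq J ->
  (forall i, i \in J -> (t < i.2)%N) ->
  (P (arrivals t @^-1` [set y] `&` cylinder J k) =
   P (arrivals t @^-1` [set y]) * P (cylinder J k))%E.
Proof.
move=> uJ tJ; rewrite arrivals_cylinderI// arrivals_cylinder.
rewrite !cylinder_prob ?slot_uniq ?slot_cat_uniq// big_cat/=; congr (_ * _)%E.
  by apply: eq_big_seq => i ii; rewrite set_slot_in.
by apply: eq_big_seq => i /tJ ti; rewrite set_slot_out.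
Qed.

(** Induction on [t]: the arrivals of the last slot of the history are moved
    into the cylinder, which is why the statement must hold for all cylinders
    over future slots and not only for the arrivals of the next one. *)
Lemma history_cylinder_indep t h J k : uniq J ->
  (forall i, i \in J -> (t <= i.2)%N) ->
  (P (arrival_history t @^-1` [set h] `&` cylinder J k) =
   P (arrival_history t @^-1` [set h]) * P (cylinder J k))%E.
Proof.
elim: t h J k => [|t IH] h J k uJ tJ.
  case: h => [|y h].
    rewrite (_ : _ @^-1` _ = setT) ?setTI ?probability_setT ?mul1e//.
    by apply/seteqP; split.
  rewrite (_ : _ @^-1` _ = set0) ?set0I ?measure0 ?mul0e//.
  by apply/seteqP; split.
case: h => [|y h]; first by rewrite arrival_history_nil set0I measure0 mul0e.
have t_slot i : i \in slot t -> (t <= i.2)%N by case/mapP => rho _ ->.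
rewrite arrival_history_cons -setIA arrivals_cylinderI//.
rewrite IH ?slot_cat_uniq//; last first.
  by move=> i; rewrite mem_cat => /orP[/t_slot//|/tJ/ltnW].
rewrite -arrivals_cylinderI// arrivals_cylinder_indep// muleA.
by rewrite arrivals_cylinder IH ?slot_uniq.
Qed.

Lemma history_arrivals_indep t h y :
  (P (arrival_history t @^-1` [set h] `&` arrivals t @^-1` [set y]) =
   P (arrival_history t @^-1` [set h]) * P (arrivals t @^-1` [set y]))%E.
Proof.
rewrite arrivals_cylinder history_cylinder_indep ?slot_uniq//.
by move=> i /mapP[rho _ ->].
Qed.

Hypothesis A_ident : forall (rho : queue) (t t' : nat),
  identically_distributed (A rho t) (A rho t').

Lemma arrivals_ident t t' y :
  P (arrivals t @^-1` [set y]) = P (arrivals t' @^-1` [set y]).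
Proof.
rewrite !arrivals_cylinder !cylinder_prob ?slot_uniq// !big_map.
by apply: eq_bigr => rho _; exact: (A_ident rho t t').
Qed.

Fixpoint run (pol : policy) (q : state) (h : seq state) : state :=
  if h is a :: h' then
    let q' := run pol q h' in next_state q' (pol q') a
  else q.

Lemma next_stateE q s t w :
  next_state q s (fun rho => A rho t w) = next_state q s (arrivals t w).
Proof. by apply/ffunP => rho; rewrite !ffunE. Qed.

Lemma queue_length_run pol q t w :
  queue_length A pol q t w = run pol q (arrival_history t w).
Proof. by elim: t => //= t IH; rewrite next_stateE IH. Qed.

Lemma queue_length_measurable pol q t :
  measurable_fibers (queue_length A pol q t).
Proof.
move=> x; rewrite (_ : _ @^-1` _ =
  arrival_history t @^-1` (run pol q @^-1` [set x])).
  exact: (@measurable_preimage_fibers _ _ _ _ _ (arrival_history_measurable t)).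
by apply/seteqP; split => w /=; rewrite queue_length_run.
Qed.

(** The Markov property. The arrivals of slot [t] are independent of the
    history before [t], of which the queue lengths are a function, and have the
    law of the arrivals of slot 0, from which [action_value] takes its
    expectation. *)
Lemma queue_length_transition pol q t (f : state -> \bar R) :
  (forall x, 0 <= f x)%E ->
  (\int[P]_w f (queue_length A pol q t.+1 w) =
   \int[P]_w (\int[P]_w' f (next_state (queue_length A pol q t w)
     (pol (queue_length A pol q t w)) (fun rho => A rho 0%N w'))))%E.
Proof.
move=> f0; pose g (h : seq state) (a : state) : \bar R :=
  f (next_state (run pol q h) (pol (run pol q h)) a).
have gE t' w w' : f (next_state (queue_length A pol q t w)
     (pol (queue_length A pol q t w)) (fun rho => A rho t' w')) =
   g (arrival_history t w) (arrivals t' w').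
  by rewrite next_stateE queue_length_run.
under eq_integral do rewrite /= gE.
under [RHS]eq_integral do under eq_integral do rewrite gE.
apply: ge0_integral_indep => //.
- exact: arrival_history_measurable.
- exact: arrivals_measurable.
- exact: arrivals_measurable.
- by move=> h y; rewrite history_arrivals_indep (arrivals_ident t 0).
- by move=> h a; exact: f0.
Qed.

End Arrivals.

(** * Discounted sums of real sequences *)

Section DiscountedSums.
Context (R : realType) (beta : R).
Hypotheses (beta_gt0 : 0 < beta) (beta_lt1 : beta < 1).

Definition discounted (x : nat -> R) : nat -> R :=
  series (fun t => beta ^+ t * x t).

Lemma discountedS x n :
  discounted x n.+1 = discounted x n + beta ^+ n * x n.
Proof. by rewrite /discounted /series/= big_nat_recr. Qed.

Lemma discounted_nondecreasing x :
  (forall t, 0 <= x t) -> nondecreasing_seq (discounted x).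
Proof.
move=> x0; apply/nondecreasing_seqP => n.
by rewrite discountedS lerDl mulr_ge0 ?exprn_ge0// ltW.
Qed.

Let onemb : 0 < 1 - beta. Proof. by rewrite subr_gt0. Qed.

Lemma beta_cvg0 : (fun n => beta ^+ n) @ \oo --> (0 : R).
Proof. by apply: cvg_expr; rewrite gtr0_norm. Qed.

(** Summation by parts of the one-step balance; stated for partial sums because
    it also provides the bounds from which both series converge. *)
Lemma discounted_balance (a e : nat -> R) (kappa : R) :
  (forall t, a t.+1 + e t = a t + kappa) -> forall n,
  (1 - beta) * discounted a n + beta ^+ n * a n + beta * discounted e n =
  a 0%N + beta * kappa / (1 - beta) * (1 - beta ^+ n).
Proof.
move=> ae; elim=> [|n IH].
  rewrite /discounted /series/= !big_geq// expr0.
  by rewrite !(mulr0, mul1r, add0r, subrr, addr0).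
have -> : a n.+1 = a n + kappa - e n by rewrite -ae addrK.
rewrite !discountedS; move: IH; rewrite exprS.
move: (beta ^+ n) (discounted a n) (discounted e n) => b J E IH.
have -> : (1 - beta) * (J + b * a n) + beta * b * (a n + kappa - e n) +
   beta * (E + b * e n) =
   ((1 - beta) * J + b * a n + beta * E) + beta * b * kappa by ring.
rewrite IH; field; exact: lt0r_neq0.
Qed.

Lemma discounted_cvg (a e : nat -> R) (kappa : R) : 0 <= kappa ->
  (forall t, 0 <= a t) -> (forall t, 0 <= e t) ->
  (forall t, a t.+1 + e t = a t + kappa) ->
  exists J E : R,
    [/\ discounted a @ \oo --> J, discounted e @ \oo --> E &
        J = (a 0%N + beta * kappa / (1 - beta) - beta * E) / (1 - beta)].
Proof.
move=> k0 a0 e0 ae; have bal := discounted_balance ae.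
set K := a 0%N + beta * kappa / (1 - beta).
have an0 (x : nat -> R) n : (forall t, 0 <= x t) -> 0 <= discounted x n.
  by move=> x0; apply: sumr_ge0 => t _; rewrite mulr_ge0 ?exprn_ge0// ltW.
have balK n : (1 - beta) * discounted a n + beta ^+ n * a n +
    beta * discounted e n <= K.
  rewrite bal lerD2l ler_piMr//; last by rewrite gerBl exprn_ge0// ltW.
  by rewrite divr_ge0 ?mulr_ge0// ltW.
have bn0 n : 0 <= beta ^+ n * a n by rewrite mulr_ge0 ?exprn_ge0// ltW.
have cvg_disc (x : nat -> R) (M : R) : (forall t, 0 <= x t) ->
    (forall n, discounted x n <= M) -> cvgn (discounted x).
  move=> x0 xM; apply: nondecreasing_is_cvgn.
    exact: discounted_nondecreasing.
  by exists M => _ [n _ <-].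
have ca : cvgn (discounted a).
  apply: (@cvg_disc _ (K / (1 - beta))) => // n.
  rewrite ler_pdivlMr// mulrC; apply: le_trans (balK n).
  by rewrite -addrA lerDl addr_ge0// mulr_ge0 ?an0// ltW.
have ce : cvgn (discounted e).
  apply: (@cvg_disc _ (K / beta)) => // n.
  rewrite ler_pdivlMr// mulrC; apply: le_trans (balK n).
  by rewrite lerDr addr_ge0// mulr_ge0 ?an0// ltW.
exists (limn (discounted a)), (limn (discounted e)); split => //.
have lhs : (fun n => (1 - beta) * discounted a n + beta ^+ n * a n +
    beta * discounted e n) @ \oo -->
    (1 - beta) * limn (discounted a) + 0 + beta * limn (discounted e).
  apply: cvgD; [apply: cvgD|]; [exact: cvgMr| |exact: cvgMr].
  exact: cvg_series_cvg_0.
have rhs : (fun n => a 0%N + beta * kappa / (1 - beta) * (1 - beta ^+ n))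
    @ \oo --> a 0%N + beta * kappa / (1 - beta) * (1 - 0).
  apply: cvgD; first exact: cvg_cst.
  apply: cvgMr; apply: cvgB; [exact: cvg_cst|exact: beta_cvg0].
move: lhs; rewrite (funext bal) => lhs.
have := cvg_unique (@norm_hausdorff _ _) lhs rhs.
rewrite addr0 subr0 mulr1 -/K => <-.
by rewrite addrK mulrC mulKf// lt0r_neq0.
Qed.

(** The reward of slot [t] is at most [u t - beta * v t.+1]. In the discounted
    sum [u t.+1] meets [- v t.+1], each pair costing at most [delta], while
    [u 0] stays alone: this is why the error is [beta * delta / (1 - beta)],
    with the leading factor [beta]. *)
Lemma discounted_reward_le (e u v : nat -> R) (delta E : R) : 0 <= delta ->
  (forall t, 0 <= v t) -> (forall t, e t + beta * v t.+1 <= u t) ->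
  (forall t, u t <= v t + delta) -> discounted e @ \oo --> E ->
  E <= u 0%N + beta * delta / (1 - beta).
Proof.
move=> d0 v0 euv uv cE; set D := beta * delta / (1 - beta).
have part n : discounted e n.+1 + beta * beta ^+ n * v n.+1 <=
    u 0%N + D * (1 - beta ^+ n).
  elim: n => [|n IH].
    rewrite discountedS /discounted /series/= big_geq// expr0.
    by have := euv 0%N; lra.
  have -> : D * (1 - beta ^+ n.+1) =
      D * (1 - beta ^+ n) + beta * beta ^+ n * delta.
    by rewrite /D exprS; field; exact: lt0r_neq0.
  rewrite discountedS !exprS; move: IH.
  have b0 : 0 <= beta * beta ^+ n by rewrite mulr_ge0 ?exprn_ge0// ltW.
  have := ler_wpM2l b0 (le_trans (euv n.+1) (uv n.+1)).
  lra.
have cE' : (fun n => discounted e n.+1) @ \oo --> E.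
  by rewrite (cvg_shiftS (discounted e)).
rewrite -(cvg_lim (@norm_hausdorff _ _) cE'); apply: limr_le.
  exact: cvgP cE'.
apply: nearW => n; have b0 : 0 <= beta ^+ n by rewrite exprn_ge0// ltW.
have bv : 0 <= beta * beta ^+ n * v n.+1 by rewrite !mulr_ge0// ltW.
have Db : 0 <= D * beta ^+ n.
  by rewrite mulr_ge0// /D divr_ge0 ?mulr_ge0// ltW.
by have := part n; lra.
Qed.

(** The same telescoping as in [discounted_reward_le]; the remainder
    [beta ^+ n.+1 * v n.+1] now has the unfavourable sign, and the bound [M]
    makes it vanish in the limit. *)
Lemma discounted_reward_ge (e u v : nat -> R) (delta E M : R) : 0 <= delta ->
  (forall t, v t <= M) -> (forall t, u t <= e t + beta * v t.+1) ->
  (forall t, v t <= u t + delta) -> discounted e @ \oo --> E ->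
  u 0%N - beta * delta / (1 - beta) <= E.
Proof.
move=> d0 vM uev vu cE; set D := beta * delta / (1 - beta).
have part n : u 0%N - D * (1 - beta ^+ n) <=
    discounted e n.+1 + beta * beta ^+ n * v n.+1.
  elim: n => [|n IH].
    rewrite discountedS /discounted /series/= big_geq// expr0.
    by have := uev 0%N; lra.
  have -> : D * (1 - beta ^+ n.+1) =
      D * (1 - beta ^+ n) + beta * beta ^+ n * delta.
    by rewrite /D exprS; field; exact: lt0r_neq0.
  rewrite discountedS !exprS; move: IH.
  have b0 : 0 <= beta * beta ^+ n by rewrite mulr_ge0 ?exprn_ge0// ltW.
  have vev : v n.+1 <= e n.+1 + beta * v n.+2 + delta.
    by apply: le_trans (vu _) _; rewrite lerD2r.
  by have := ler_wpM2l b0 vev; lra.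
have cEM : (fun n => discounted e n.+1 + beta * beta ^+ n * M) @ \oo --> E.
  rewrite -[X in _ --> X]addr0 -(mul0r M) -[X in _ + X * _](mulr0 beta).
  apply: cvgD; first by rewrite (cvg_shiftS (discounted e)).
  by apply: cvgMl; apply: cvgMr; exact: beta_cvg0.
rewrite -(cvg_lim (@norm_hausdorff _ _) cEM); apply: limr_ge.
  exact: cvgP cEM.
apply: nearW => n; have b0 : 0 <= beta ^+ n by rewrite exprn_ge0// ltW.
have bv : beta * beta ^+ n * v n.+1 <= beta * beta ^+ n * M.
  by rewrite ler_wpM2l// mulr_ge0// ltW.
have Db : 0 <= D * beta ^+ n.
  by rewrite mulr_ge0// /D divr_ge0 ?mulr_ge0// ltW.
by have := part n; lra.
Qed.

End DiscountedSums.

(** * Value iteration *)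

Section Switch.
Context (R : realType) (d : measure_display) (T : measurableType d).
Context (P : probability T R) (A : queue -> nat -> {RV P >-> nat}).
Context (c : queue -> R) (beta : R).
Hypothesis c_ge0 : forall rho : queue, 0 <= c rho.
Hypotheses (beta_gt0 : 0 < beta) (beta_lt1 : beta < 1).

Notation value := (value A c beta).
Notation action_value := (action_value A c beta).
Notation next x s := (fun w => next_state x s (fun rho => A rho 0%N w)).

Definition holding_cost (x : queue -> nat) : R := \sum_rho c rho * (x rho)%:R.

Lemma holding_cost_ge0 x : 0 <= holding_cost x.
Proof. by apply: sumr_ge0 => rho _; rewrite mulr_ge0. Qed.

(** Work conservation: the reward is the holding cost that service removes,
    since a job leaves exactly those scheduled queues that are nonempty. *)
Lemma holding_cost_balance (q : state) (s : svec) (a : queue -> nat) :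
  holding_cost (next_state q s a) + reward c q s =
  holding_cost q + holding_cost a.
Proof.
rewrite /holding_cost /reward -!big_split/=; apply: eq_bigr => rho _.
rewrite ffunE -mulrA -!mulrDr; congr (_ * _).
rewrite -natrM -!natrD; congr (_%:R).
by case: (s rho) (q rho) => -[|n] //=; lia.
Qed.

Lemma reward_ge0 q s : 0 <= reward c q s.
Proof. by apply: sumr_ge0 => rho _; rewrite !mulr_ge0. Qed.

Definition total_cost_rate : R := \sum_rho c rho.

Lemma total_cost_rate_ge0 : 0 <= total_cost_rate.
Proof. exact: sumr_ge0. Qed.

Lemma reward_le q s : reward c q s <= total_cost_rate.
Proof.
apply: ler_sum => rho _; rewrite -mulrA ler_piMr//.
by case: (s rho); case: (0 < q rho)%N; rewrite ?mulr1 ?mulr0 ?mul0r.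
Qed.

Lemma measurable_next (V : state -> \bar R) x s :
  measurable_fun setT (fun w => V (next x s w)).
Proof.
under eq_fun do rewrite next_stateE.
have := @measurable_fun_fibers _ _ _ (arrivals A 0) _ (\bar R)
  (fun a => V (next_state x s a)) setT (arrivals_measurable A 0).
exact.
Qed.

Lemma action_value_ge0 (V : state -> \bar R) q s :
  (forall x, 0 <= V x)%E -> (0 <= action_value V q s)%E.
Proof.
move=> V0; rewrite adde_ge0 ?lee_fin ?reward_ge0//.
rewrite mule_ge0 ?lee_fin ?(ltW beta_gt0)//.
exact: integral_ge0.
Qed.

(** The Bellman operator is monotone, and a constant added to the value
    function comes out multiplied by [beta] because [P] is a probability. *)
Lemma action_value_le_add (V W : state -> \bar R) (delta : R) q s :
  0 <= delta -> (forall x, 0 <= V x)%E -> (forall x, 0 <= W x)%E ->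
  (forall x, V x <= W x + delta%:E)%E ->
  (action_value V q s <= action_value W q s + (beta * delta)%:E)%E.
Proof.
move=> d0 V0 W0 VW; rewrite /Defs.action_value -addeA leeD2l//.
rewrite EFinM -ge0_muleDr ?lee_fin ?integral_ge0//.
apply: lee_wpmul2l; first by rewrite lee_fin ltW.
have -> : (\int[P]_w W (next q s w) + delta%:E =
    \int[P]_w (W (next q s w) + delta%:E))%E.
  rewrite ge0_integralD//; last exact: measurable_next.
  by rewrite integral_cst_prob.
apply: ge0_le_integral => //.
- exact: measurable_next.
- by apply: emeasurable_funD => //; exact: measurable_next.
Qed.

Definition idle : svec := [ffun=> false].

Lemma idle_schedule : is_schedule idle.
Proof.
by apply/andP; split; apply/forallP => i; rewrite big1// => j _; rewrite ffunE.
Qed.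

Lemma action_value_le_value n q s : is_schedule s ->
  (action_value (value n) q s <= value n.+1 q)%E.
Proof. by move=> sS; apply: le_bigmax_cond. Qed.

(** With [action_value_le_value] this says that the next value is the least
    upper bound of the action values, the form in which comparisons use it. *)
Lemma value_lub n q (M : \bar R) :
  (forall s, is_schedule s -> action_value (value n) q s <= M)%E ->
  (value n.+1 q <= M)%E.
Proof. by move=> sM; apply: bigmax_le => //; exact: leNye. Qed.

Lemma value_ge0 n q : (0 <= value n q)%E.
Proof.
elim: n q => [//|n IH] q.
apply: le_trans (action_value_le_value n q idle_schedule).
exact: action_value_ge0.
Qed.

(** The discounted total when [total_cost_rate] is earned in every slot. *)
Definition value_bound : R := total_cost_rate / (1 - beta).

Lemma value_bound_ge0 : 0 <= value_bound.
Proof. by rewrite divr_ge0 ?total_cost_rate_ge0// subr_ge0 ltW. Qed.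

Lemma action_value0 q s : action_value (fun=> 0%E) q s = (reward c q s)%:E.
Proof. by rewrite /Defs.action_value integral0 mule0 adde0. Qed.

Lemma value_le n q : (value n q <= value_bound%:E)%E.
Proof.
elim: n q => [|n IH] q; first by rewrite lee_fin value_bound_ge0.
apply: value_lub => s _.
apply: (le_trans (@action_value_le_add _ (fun=> 0%E) value_bound q s
  value_bound_ge0 (value_ge0 n) (fun=> lexx _) _)) => [x|].
  by rewrite add0e.
rewrite action_value0 -EFinD lee_fin.
rewrite [leRHS](_ : _ = total_cost_rate + beta * value_bound); last first.
  by rewrite /value_bound; field; rewrite subr_eq0 gt_eqF.
by rewrite lerD2r reward_le.
Qed.

Lemma value_fin n q : value n q \is a fin_num.
Proof.
by rewrite ge0_fin_numE ?value_ge0// (le_lt_trans (value_le n q)) ?ltry.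
Qed.

(** One-sided, so that it applies to both signs of the difference without
    subtracting extended reals. *)
Lemma value_contract m n (delta : R) : 0 <= delta ->
  (forall x, value m x <= value n x + delta%:E)%E ->
  forall x, (value m.+1 x <= value n.+1 x + (beta * delta)%:E)%E.
Proof.
move=> d0 mn x; apply: value_lub => s sS.
have := action_value_le_add x s d0 (value_ge0 m) (value_ge0 n) mn.
by move/le_trans; apply; rewrite leeD2r// action_value_le_value.
Qed.

Lemma value_gap n :
  (forall x, value n.+1 x <= value n x + (beta ^+ n * total_cost_rate)%:E)%E /\
  (forall x, value n x <= value n.+1 x + (beta ^+ n * total_cost_rate)%:E)%E.
Proof.
have C0 := total_cost_rate_ge0.
elim: n => [|n [IH1 IH2]].
  rewrite expr0 mul1r; split => x; last by rewrite adde_ge0 ?value_ge0.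
  apply: value_lub => s _.
  by rewrite /= action_value0 add0e lee_fin reward_le.
have d0 : 0 <= beta ^+ n * total_cost_rate by rewrite mulr_ge0 ?exprn_ge0// ltW.
by rewrite exprS -mulrA; split; exact: value_contract.
Qed.

(** The only use of the greedy choice: for a look-ahead policy the Bellman
    inequality is an equality. *)
Lemma lookahead_value l pol x : lookahead_policy A c beta l pol ->
  value l.+1 x = action_value (value l) x (pol x).
Proof.
move=> [polS polmax]; apply/eqP; rewrite eq_le; apply/andP; split.
  by apply: value_lub => s sS; exact: polmax.
by apply: action_value_le_value; exact: polS.
Qed.


(** * Mean costs and rewards along a policy *)

Hypothesis A_indep :
  mutually_independent (fun k : queue * nat => A k.1 k.2).
Hypothesis A_ident : forall (rho : queue) (t t' : nat),
  identically_distributed (A rho t) (A rho t').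
Context (lambda : queue -> R).
Hypothesis A_mean : forall (rho : queue) (t : nat),
  ('E_P[fun w => (A rho t w)%:R] = (lambda rho)%:E)%E.

(** The drift of the holding cost that no policy can influence. *)
Definition arrival_cost : R := \sum_rho c rho * lambda rho.

Lemma measurable_arrival_count rho t :
  measurable_fun setT (fun w => ((A rho t w)%:R : R)%:E).
Proof.
apply: (@measurable_fun_fibers _ _ _ (A rho t) _ (\bar R) (fun n => n%:R%:E)).
by move=> n; rewrite -[X in measurable X]setTI; exact: measurable_funPT.
Qed.

Lemma arrival_cost_ge0 : 0 <= arrival_cost.
Proof.
apply: sumr_ge0 => rho _; rewrite mulr_ge0// -lee_fin -(A_mean rho 0).
by rewrite unlock; apply: integral_ge0 => w _; rewrite lee_fin.
Qed.

Lemma integral_arrival_cost t :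
  (\int[P]_w (holding_cost (fun rho => A rho t w))%:E = arrival_cost%:E)%E.
Proof.
under eq_integral do rewrite /holding_cost -sumEFin.
rewrite ge0_integral_sum//=.
- rewrite /arrival_cost -sumEFin; apply: eq_bigr => rho _.
  under eq_integral do rewrite EFinM.
  rewrite ge0_integralZl ?lee_fin//; last exact: measurable_arrival_count.
  by have := A_mean rho t; rewrite unlock EFinM => <-.
- move=> rho; under eq_fun do rewrite EFinM.
  by apply: measurable_funeM; exact: measurable_arrival_count.
- by move=> rho w _; rewrite lee_fin mulr_ge0.
Qed.

Section FixedPolicy.
Context (pol : policy) (q : state).

Notation Q := (queue_length A pol q).

Lemma measurable_queue_length (V : state -> \bar R) t :
  measurable_fun setT (fun w => V (Q t w)).
Proof.
have := @measurable_fun_fibers _ _ _ (Q t) _ (\bar R) V setT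
  (queue_length_measurable A pol q t).
exact.
Qed.

Definition mean_cost t : \bar R := (\int[P]_w (holding_cost (Q t w))%:E)%E.
Definition mean_reward t : \bar R :=
  (\int[P]_w (reward c (Q t w) (pol (Q t w)))%:E)%E.
Definition mean_value n t : \bar R := (\int[P]_w value n (Q t w))%E.

Lemma mean_cost_balance t :
  (mean_cost t.+1 + mean_reward t = mean_cost t + arrival_cost%:E)%E.
Proof.
have mh t' : measurable_fun setT (fun w => (holding_cost (Q t' w))%:E).
  exact: (measurable_queue_length (fun x => (holding_cost x)%:E)).
rewrite /mean_cost /mean_reward -(integral_arrival_cost t) -!ge0_integralD//.
- by apply: eq_integral => w _; rewrite -!EFinD/= holding_cost_balance.
- by move=> w _; rewrite lee_fin holding_cost_ge0.
- by move=> w _; rewrite lee_fin holding_cost_ge0.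
- under eq_fun do rewrite /holding_cost -sumEFin.
  apply: emeasurable_sum => rho.
  under eq_fun do rewrite EFinM.
  by apply: measurable_funeM; exact: measurable_arrival_count.
- by move=> w _; rewrite lee_fin holding_cost_ge0.
- by move=> w _; rewrite lee_fin reward_ge0.
- exact: (measurable_queue_length (fun x => (reward c x (pol x))%:E)).
Qed.

Lemma mean_cost0 : mean_cost 0 = (holding_cost q)%:E.
Proof. by rewrite /mean_cost/= integral_cst_prob. Qed.

Lemma mean_value0 n : mean_value n 0 = value n q.
Proof. by rewrite /mean_value/= integral_cst_prob. Qed.

Lemma mean_cost_ge0 t : (0 <= mean_cost t)%E.
Proof. by apply: integral_ge0 => w _; rewrite lee_fin holding_cost_ge0. Qed.

Lemma mean_reward_ge0 t : (0 <= mean_reward t)%E.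
Proof. by apply: integral_ge0 => w _; rewrite lee_fin reward_ge0. Qed.

Lemma mean_value_ge0 n t : (0 <= mean_value n t)%E.
Proof. by apply: integral_ge0 => w _; exact: value_ge0. Qed.

(** The balance bounds both terms on its left by a right-hand side that is
    finite by induction. *)
Lemma mean_cost_reward_fin t :
  mean_cost t \is a fin_num /\ mean_reward t \is a fin_num.
Proof.
have step t' : mean_cost t' \is a fin_num ->
    (mean_cost t'.+1 \is a fin_num) && (mean_reward t' \is a fin_num).
  by move=> cf; rewrite -fin_numD mean_cost_balance fin_numD cf.
have cf t' : mean_cost t' \is a fin_num.
  by elim: t' => [|t' /step/andP[]//]; rewrite mean_cost0.
by split => //; have /andP[] := step _ (cf t).
Qed.

Lemma mean_value_le n t : (mean_value n t <= (value_bound)%:E)%E.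
Proof.
rewrite -[leRHS](@integral_cst_prob _ _ _ P); apply: ge0_le_integral => //.
- by move=> w _; exact: value_ge0.
- exact: measurable_queue_length.
- by move=> w _; exact: value_le.
Qed.

Lemma mean_value_fin n t : mean_value n t \is a fin_num.
Proof.
rewrite ge0_fin_numE ?mean_value_ge0//.
by rewrite (le_lt_trans (mean_value_le n t)) ?ltry.
Qed.

Lemma mean_value_le_add m n (delta : R) t : 0 <= delta ->
  (forall x, value m x <= value n x + delta%:E)%E ->
  (mean_value m t <= mean_value n t + delta%:E)%E.
Proof.
move=> d0 mn; rewrite -[X in (_ + X)%E](@integral_cst_prob _ _ _ P).
rewrite -ge0_integralD//=; last 2 first.
- by move=> w _; exact: value_ge0.
- exact: measurable_queue_length.
apply: ge0_le_integral => //.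
- by move=> w _; exact: value_ge0.
- exact: measurable_queue_length.
- by apply: emeasurable_funD => //; exact: measurable_queue_length.
Qed.

(** The Markov property turns the expectation over a fresh copy of the
    arrivals, inside [action_value], into the mean value one slot later. *)
Lemma mean_action_value n t :
  (\int[P]_w action_value (value n) (Q t w) (pol (Q t w)) =
   mean_reward t + beta%:E * mean_value n t.+1)%E.
Proof.
rewrite /mean_value queue_length_transition//; last first.
  by move=> x; exact: value_ge0.
pose W x := (\int[P]_w' value n (next x (pol x) w'))%E.
have W0 x : (0 <= W x)%E by apply: integral_ge0 => w _; exact: value_ge0.
have mW := measurable_queue_length W t.
rewrite -ge0_integralZl//; last by rewrite lee_fin ltW.
rewrite -ge0_integralD//.
- by move=> w _; rewrite lee_fin reward_ge0.
- exact: (measurable_queue_length (fun x => (reward c x (pol x))%:E)).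
- move=> w _; apply: mule_ge0; first by rewrite lee_fin ltW.
  exact: (W0 (Q t w)).
- exact: measurable_funeM.
- by move=> w _; exact: (W0 (Q t w)).
Qed.

Lemma discounted_costE : discounted_cost A c beta q pol =
  (\sum_(0 <= t <oo) (beta ^+ t * fine (mean_cost t))%:E)%E.
Proof.
apply: eq_eseriesr => t _.
rewrite unlock EFinM fineK ?(mean_cost_reward_fin t).1//.
under eq_integral do rewrite EFinM.
rewrite ge0_integralZl//.
- exact: (measurable_queue_length (fun x => (holding_cost x)%:E)).
- by move=> w _; rewrite lee_fin holding_cost_ge0.
- by rewrite lee_fin exprn_ge0// ltW.
Qed.

End FixedPolicy.

(** * From the discounted reward to the cost *)

(** The discounted cost of any policy whose discounted reward is [r]: the limit
    of [discounted_balance], solved for the cost. *)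
Definition cost_of_reward (q : state) (r : R) : R :=
  (holding_cost q + beta * arrival_cost / (1 - beta) - beta * r) / (1 - beta).

Lemma cost_of_reward_le q r r' :
  r <= r' -> cost_of_reward q r' <= cost_of_reward q r.
Proof.
move=> rr'; rewrite ler_wpM2r ?invr_ge0 ?subr_ge0 ?(ltW beta_lt1)//.
by rewrite lerD2l lerN2 ler_wpM2l// ltW.
Qed.

Lemma discounted_cost_of_reward pol q : exists E : R,
  discounted beta (fun t => fine (mean_reward pol q t)) @ \oo --> E /\
  discounted_cost A c beta q pol = (cost_of_reward q E)%:E.
Proof.
pose a t := fine (mean_cost pol q t).
have [t|t|t|J [E [cJ cE JE]]] := @discounted_cvg _ _ beta_gt0 beta_lt1 a
    (fun t => fine (mean_reward pol q t)) _ arrival_cost_ge0.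
- by rewrite fine_ge0// mean_cost_ge0.
- by rewrite fine_ge0// mean_reward_ge0.
- have [f1 f2] := mean_cost_reward_fin pol q t.
  have [f3 _] := mean_cost_reward_fin pol q t.+1.
  have := mean_cost_balance pol q t.
  by rewrite -(fineK f1) -(fineK f2) -(fineK f3) -!EFinD => -[].
exists E; split => //; rewrite discounted_costE.
have aq : a 0%N = holding_cost q by rewrite /a mean_cost0.
rewrite /cost_of_reward -aq -JE; apply: cvg_lim => //.
rewrite (_ : (fun n => _) = EFin \o discounted beta a).
  exact: cvg_comp cJ _.
by apply/funext => n; rewrite /= /discounted /series/= -sumEFin.
Qed.

Section ValueGap.
Context (l : nat) (delta : R).
Hypothesis delta_ge0 : 0 <= delta.
Hypothesis value_up : forall x, (value l.+1 x <= value l x + delta%:E)%E.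
Hypothesis value_down : forall x, (value l x <= value l.+1 x + delta%:E)%E.

Lemma discounted_cost_ge pol q : is_policy pol ->
  ((cost_of_reward q
     (fine (value l.+1 q) + beta * delta / (1 - beta)))%:E <=
   discounted_cost A c beta q pol)%E.
Proof.
move=> polS; have [E [cE ->]] := discounted_cost_of_reward pol q.
rewrite lee_fin; apply: cost_of_reward_le; rewrite -(mean_value0 pol q).
apply: (discounted_reward_le beta_gt0 beta_lt1 delta_ge0
  (u := fun t => fine (mean_value pol q l.+1 t))
  (v := fun t => fine (mean_value pol q l t)) _ _ _ cE) => t.
- by rewrite fine_ge0// mean_value_ge0.
- rewrite -lee_fin EFinD EFinM !fineK ?mean_value_fin//; last first.
    by case: (mean_cost_reward_fin pol q t).
  rewrite -mean_action_value; apply: ge0_le_integral => //.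
  + by move=> w _; apply: action_value_ge0 => x; exact: value_ge0.
  + exact: (measurable_queue_length pol q
      (fun x => action_value (value l) x (pol x))).
  + exact: measurable_queue_length.
  + by move=> w _; apply: action_value_le_value; exact: polS.
- by rewrite -lee_fin EFinD !fineK ?mean_value_fin// mean_value_le_add.
Qed.

Lemma discounted_cost_le pol q : lookahead_policy A c beta l pol ->
  (discounted_cost A c beta q pol <=
   (cost_of_reward q
     (fine (value l.+1 q) - beta * delta / (1 - beta)))%:E)%E.
Proof.
move=> polL; have [E [cE ->]] := discounted_cost_of_reward pol q.
rewrite lee_fin; apply: cost_of_reward_le; rewrite -(mean_value0 pol q).
apply: (discounted_reward_ge beta_gt0 beta_lt1 (M := value_bound) delta_ge0
  (u := fun t => fine (mean_value pol q l.+1 t))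
  (v := fun t => fine (mean_value pol q l t)) _ _ _ cE) => t.
- by rewrite -lee_fin fineK ?mean_value_fin// mean_value_le.
- rewrite -lee_fin EFinD EFinM !fineK ?mean_value_fin//; last first.
    by case: (mean_cost_reward_fin pol q t).
  rewrite -mean_action_value le_eqVlt; apply/orP; left; apply/eqP.
  by apply: eq_integral => w _; exact: lookahead_value.
- by rewrite -lee_fin EFinD !fineK ?mean_value_fin// mean_value_le_add.
Qed.

(** The lower bound on the cost holds for every policy, hence for the infimum,
    and the upper bound holds for the look-ahead policy; they differ by
    [2 * beta * delta / (1 - beta)] in reward, that is, by the stated amount in
    cost. *)
Lemma lookahead_gap pol : lookahead_policy A c beta l pol ->
  (supnorm (fun q : state =>
     discounted_cost A c beta q pol - optimal_cost A c beta q) <=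
   (2 * beta ^+ 2 * delta / (1 - beta) ^+ 2)%:E)%E.
Proof.
move=> polL; apply: ge_ereal_sup => _ [q _ <-].
have := discounted_cost_le q polL.
set hi := cost_of_reward q _ => Jhi.
have : ((cost_of_reward q
    (fine (value l.+1 q) + beta * delta / (1 - beta)))%:E <=
    optimal_cost A c beta q)%E.
  by apply: le_ereal_inf_tmp => _ [pol' polS <-]; exact: discounted_cost_ge.
set lo := cost_of_reward q _ => loV.
have VJ : (optimal_cost A c beta q <= discounted_cost A c beta q pol)%E.
  by apply: ereal_inf_lbound; exists pol => //; case: polL.
have Vhi := le_trans VJ Jhi; have loJ := le_trans loV VJ.
(* Both costs lie between the finite bounds [lo] and [hi]. *)
move: (optimal_cost A c beta q) (discounted_cost A c beta q pol)
  Jhi loV VJ Vhi loJ => [V| |] [J| |] //.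
rewrite !lee_fin => Jhi loV VJ _ _; rewrite ger0_norm ?subr_ge0//.
have -> : 2 * beta ^+ 2 * delta / (1 - beta) ^+ 2 = hi - lo.
  rewrite /hi /lo /cost_of_reward; field.
  by rewrite subr_eq0 gt_eqF.
exact: lerB.
Qed.

End ValueGap.

End Switch.

(** * Performance of look-ahead policies *)

Theorem theorem6 (R : realType) (d : measure_display) (T : measurableType d)
  (P : probability T R) (A : queue -> nat -> {RV P >-> nat})
  (lambda : queue -> R) (c : queue -> R) (beta : R) (pol : nat -> policy)
  (A_indep : mutually_independent (fun k : queue * nat => A k.1 k.2))
  (A_ident : forall (rho : queue) (t t' : nat),
     identically_distributed (A rho t) (A rho t'))
  (A_mean : forall (rho : queue) (t : nat),
     ('E_P[fun w => (A rho t w)%:R] = (lambda rho)%:E)%E)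
  (load_out : forall j : 'I_2, \sum_(i < 2) lambda (i, j) < 1)
  (load_in : forall i : 'I_2, \sum_(j < 2) lambda (i, j) < 1)
  (c_ge0 : forall rho : queue, 0 <= c rho)
  (beta_gt0 : 0 < beta) (beta_lt1 : beta < 1)
  (pol_lookahead : forall l : nat, (1 <= l)%N ->
     lookahead_policy A c beta l (pol l)) :
  ((fun l : nat => supnorm (fun q : state =>
      (discounted_cost A c beta q (pol l) - optimal_cost A c beta q)%E))
     @ \oo --> (0%E : \bar R)) /\
  (forall (l : nat) (eps : R), (1 <= l)%N -> 0 < eps ->
     (supnorm (fun q : state =>
        value A c beta l.+1 q - value A c beta l q)
      < (eps * (1 - beta) ^+ 2 / (2 * beta ^+ 2))%:E)%E ->
     (supnorm (fun q : state =>
        discounted_cost A c beta q (pol l) - optimal_cost A c beta q)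
      < eps%:E)%E).
Proof.
have C0 := total_cost_rate_ge0 c_ge0.
have gap l (delta : R) (l1 : (1 <= l)%N) (d0 : 0 <= delta) up down :=
  lookahead_gap c_ge0 beta_gt0 beta_lt1 A_indep A_ident A_mean (l := l) d0
    up down (pol_lookahead l l1).
have sup0 (f : state -> \bar R) : (0 <= supnorm f)%E.
  apply: (@le_trans _ _ `|f [ffun=> 0%N]|%E); first exact: abse_ge0.
  by apply: ereal_sup_ubound; exists [ffun=> 0%N].
split.
  pose K : R := 2 * beta ^+ 2 * total_cost_rate c / (1 - beta) ^+ 2.
  apply: (@squeeze_cvge _ _ _ _ (fun=> 0%E) _ (fun l => (beta ^+ l * K)%:E)).
  - near=> l; rewrite sup0/=.
    have [up down] := value_gap A c_ge0 beta_gt0 l.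
    apply: le_trans (gap l _ _ _ up down) _.
    + by near: l; exists 1%N.
    + by rewrite mulr_ge0// exprn_ge0// ltW.
    + by rewrite (_ : 2 * _ * _ / _ = beta ^+ l * K)// /K; ring.
  - exact: cvg_cst.
  - apply: cvg_EFin; first exact: nearW.
    rewrite -[X in _ --> X](mul0r K); apply: cvgMl; exact: beta_cvg0.
move=> l eps l1 eps0.
set S := supnorm _ => Slt.
have Sfin : S \is a fin_num.
  by rewrite ge0_fin_numE ?sup0// (lt_trans Slt) ?ltry.
have VS q : (`|value A c beta l.+1 q - value A c beta l q| <= S)%E.
  by apply: ereal_sup_ubound; exists q.
have [f1 f2] := (value_fin A c_ge0 beta_gt0 beta_lt1 l,
                value_fin A c_ge0 beta_gt0 beta_lt1 l.+1).
have S0 : 0 <= fine S by rewrite fine_ge0 ?sup0.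
apply: le_lt_trans (gap l (fine S) l1 S0 _ _) _.
- move=> q; have := VS q; rewrite -(fineK Sfin) -(fineK (f1 q)) -(fineK (f2 q)).
  by rewrite -EFinB -EFinD !lee_fin ler_norml; lra.
- move=> q; have := VS q; rewrite -(fineK Sfin) -(fineK (f1 q)) -(fineK (f2 q)).
  by rewrite -EFinB -EFinD !lee_fin ler_norml; lra.
- move: Slt; rewrite -(fineK Sfin) !lte_fin ltr_pdivlMr; last first.
    by rewrite mulr_gt0// exprn_gt0.
  rewrite ltr_pdivrMr ?exprn_gt0 ?subr_gt0//.
  lra.
Unshelve. all: by end_near.
Qed.
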